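(* Let $(I_x)_{x\in\mathbf{Z}}$ be real numbers satisfying $I_n=I_{-n+1}$ for every $n\in\mathbf{Z}$, and let $\beta>0$. Then for every integer $n\ge 0$ the partition functions $Z_n^+=\sum_{\sigma\in\Omega_n}\exp\{-\beta H_n^+(\sigma)\}$ and $Z_n^{\pm}=\sum_{\sigma\in\Omega_n}\exp\{-\beta H_n^{\pm}(\sigma)\}$ have the form $$Z_n^+=\frac12\left(\prod_{i=0}^n\left(1+e^{-\beta I_{i+1}}\right)^2+\prod_{i=0}^n\left(1-e^{-\beta I_{i+1}}\right)^2\right),$$ $$Z_n^{\pm}=\frac12\left(\prod_{i=0}^n\left(1+e^{-\beta I_{i+1}}\right)^2-\prod_{i=0}^n\left(1-e^{-\beta I_{i+1}}\right)^2\right).$$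
   Context: For an integer $n\ge 0$ let $\Lambda_n=[-n,n]\cap\mathbf{Z}$ and $\Omega_n=\{-1,1\}^{\Lambda_n}$, the set of all functions (configurations) $\sigma:\Lambda_n\to\{-1,1\}$. Here $\mathbf{1}_{A}$ equals $1$ if the condition $A$ holds and $0$ otherwise. For $\sigma\in\Omega_n$, the energy with ''$+$'' boundary condition is $$H_n^+(\sigma)=\sum_{x=-n+1}^{n} I_x\,\mathbf{1}_{\sigma(x-1)\neq\sigma(x)}+I_{-n}\,\mathbf{1}_{\sigma(-n)\neq 1}+I_{n+1}\,\mathbf{1}_{\sigma(n)\neq 1},$$ and the energy with ''$\pm$'' boundary condition is $$H_n^{\pm}(\sigma)=H_n^+(\sigma)+I_{-n}\,\sigma(-n).$$ *)

(* Defs.v *)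
From HB Require Import structures.
From mathcomp Require Import all_boot all_order all_algebra.
From mathcomp Require Import reals sequences exp.

Set Implicit Arguments.
Unset Strict Implicit.
Unset Printing Implicit Defensive.

Import Order.TTheory GRing.Theory Num.Theory.
Local Open Scope ring_scope.

(* [a, b] in Z, in increasing order; empty when b < a. *)
Definition zitv (a b : int) : seq int :=
  [seq a + i%:Z | i <- iota 0 (absz (Num.max 0 (b - a + 1)))].

Lemma mem_zitv (a b x : int) : (x \in zitv a b) = (a <= x <= b).
Proof.
apply/mapP/andP => [[i] | [ax xb]].
  rewrite mem_iota add0n /= -ltz_nat gez0_abs ?le_max ?lexx // => ib ->.
  rewrite lerDl; split => //; rewrite addrC -lerBrDr.
  by move: ib; rewrite lt_max ltz_nat ltn0 /= ltzD1.
exists (absz (x - a)); last by rewrite gez0_abs ?subr_ge0 // subrKC.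
rewrite mem_iota add0n /= -ltz_nat !gez0_abs ?subr_ge0 ?le_max ?lexx //.
by rewrite lt_max ltzD1 lerB ?orbT.
Qed.

Lemma zitv_uniq (a b : int) : uniq (zitv a b).
Proof. by rewrite map_inj_uniq ?iota_uniq // => i j /addrI []. Qed.

Definition Lambda (n : nat) : finType := seq_sub (zitv (- n%:Z) n%:Z).

Definition spin : finType := seq_sub [:: -1; 1 : int].

Definition Omega (n : nat) : finType := {ffun Lambda n -> spin}.

(* The value sigma(x) as an integer.  The junk value 0 outside Lambda n is
   never reached in the energies below. *)
Definition at_site (n : nat) (sigma : Omega n) (x : int) : int :=
  if insub x is Some u then val (sigma u) else 0.

Lemma at_siteE (n : nat) (sigma : Omega n) (u : Lambda n) :
  at_site sigma (val u) = val (sigma u).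
Proof. by rewrite /at_site valK. Qed.

Section Energy.
Variables (R : realType) (I : int -> R) (beta : R) (n : nat).

Definition Hplus (sigma : Omega n) : R :=
  \sum_(x <- zitv (- n%:Z + 1) n%:Z)
     I x * (at_site sigma (x - 1) != at_site sigma x)%:R
  + I (- n%:Z) * (at_site sigma (- n%:Z) != 1)%:R
  + I (n%:Z + 1) * (at_site sigma n%:Z != 1)%:R.

Definition Hpm (sigma : Omega n) : R :=
  Hplus sigma + I (- n%:Z) * (at_site sigma (- n%:Z))%:~R.

Definition Zplus : R := \sum_(sigma : Omega n) expR (- beta * Hplus sigma).

Definition Zpm : R := \sum_(sigma : Omega n) expR (- beta * Hpm sigma).

End Energy.

(* Main.v *)
Require Import Defs.
From mathcomp Require Import all_boot all_order all_algebra.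
From mathcomp Require Import reals sequences exp.
From mathcomp Require Import zify ring.

Import Order.TTheory GRing.Theory Num.Theory.
Local Open Scope ring_scope.

(* With the spins encoded as booleans ([true] for +1), both energies are
   nearest-neighbour chains of 2n+1 free spins between a left boundary spin
   (+ for Z^+, - for Z^pm, since the extra term turns
   [I_{-n} 1_{sigma(-n) <> 1}] into [I_{-n} 1_{sigma(-n) <> -1}]) and a right
   boundary spin +.  The transfer matrices (1 w; w 1) are diagonalised
   simultaneously by (1, 1) and (1, -1) with eigenvalues 1 + w and 1 - w, and
   the symmetry I_x = I_{1-x} makes every bond weight occur twice. *)

Lemma big_tuple_cons (R : nmodType) (T : finType) (m : nat)
    (F : m.+1.-tuple T -> R) :
  \sum_t F t = \sum_a \sum_(t : m.-tuple T) F [tuple of a :: t].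
Proof.
rewrite pair_big /= (reindex (fun p : T * m.-tuple T => [tuple of p.1 :: p.2])) //.
exists (fun t => (thead t, [tuple of behead t])) => [[a t] _|t _] /=.
  by congr pair; apply: val_inj.
by rewrite [RHS]tuple_eta.
Qed.

(* [nth true] supplies the right boundary spin: index m of [t] is out of
   range. *)
Lemma chain_partition_function (R : numFieldType) (m : nat) (w : nat -> R)
    (b : bool) :
  \sum_(t : m.-tuple bool)
     \prod_(k < m.+1) w k ^+ (nth true (b :: t) k != nth true t k) =
  2^-1 * (\prod_(k < m.+1) (1 + w k) + (-1) ^+ (~~ b) * \prod_(k < m.+1) (1 - w k)).
Proof.
have two_neq0 : 2 != 0 :> R by rewrite pnatr_eq0.
elim: m w b => [|m IH] w b.
  rewrite (big_pred1 [tuple]) => [|t]; last by rewrite [t]tuple0 /= eqxx.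
  by rewrite !big_ord1 /=; case: b => /=; field.
(* Fixing the first spin [a] leaves a shorter chain with shifted weights and left boundary spin [a];
   summing over [a] produces the factors [1 + w 0] and [1 - w 0]. *)
rewrite big_tuple_cons.
under eq_bigr => a _.
  under eq_bigr => t _ do rewrite big_ord_recl /=.
  rewrite -mulr_sumr (IH (fun k => w k.+1) a).
  over.
rewrite big_bool /= !(big_ord_recl m.+1) /=.
by case: b => /=; field.
Qed.

Lemma spin_sign_proof (b : bool) : (-1) ^+ (~~ b) \in [:: -1; 1 : int].
Proof. by case: b. Qed.

Definition spin_of_bool (b : bool) : spin := SeqSub (spin_sign_proof b).

(** Site [x] is read from index [x + n], which runs from [0] to [2n]; the absolute value only casts
    this nonnegative integer to [nat]. *)
Definition Omega_of_tuple (n : nat) (t : (n + n).+1.-tuple bool) : Omega n :=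
  [ffun u : Lambda n => spin_of_bool (nth true t `|(val u + n%:Z)%R|%N)].

Lemma at_site_Omega_of_tuple (n : nat) (t : (n + n).+1.-tuple bool) (k : nat) :
  (k <= n + n)%N ->
  at_site (Omega_of_tuple n t) (- n%:Z + k%:Z) = (-1) ^+ (~~ nth true t k).
Proof.
move=> kn; have xL : - n%:Z + k%:Z \in zitv (- n%:Z) n%:Z.
  by rewrite mem_zitv; lia.
rewrite -[- n%:Z + k%:Z]/(val (SeqSub xL : Lambda n)) at_siteE ffunE /=.
by congr (_ ^+ (~~ nth _ _ _)); lia.
Qed.

Lemma Omega_of_tuple_bij (n : nat) : bijective (Omega_of_tuple n).
Proof.
exists (fun s : Omega n =>
  [tuple at_site s (- n%:Z + k%:Z) == 1 | k < (n + n).+1]).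
  move=> t; apply: eq_from_tnth => k.
  rewrite tnth_mktuple at_site_Omega_of_tuple -1?ltnS // (tnth_nth true).
  by case: nth.
move=> s; apply/ffunP => u; rewrite ffunE; apply: val_inj.
have := valP u; rewrite mem_zitv => uL.
have kn : (`|(val u + n%:Z)%R|%N < (n + n).+1)%N by lia.
rewrite -[`|_|%N]/(nat_of_ord (Ordinal kn)) -tnth_nth tnth_mktuple /=.
have -> : - n%:Z + `|(val u + n%:Z)%R|%N%:Z = val u by lia.
rewrite at_siteE; have := valP (s u).
by rewrite !inE -[RHS]/(val (s u)) => /orP[] /eqP ->.
Qed.

Section Energy.
Variables (R : realType) (I : int -> R) (n : nat).
Implicit Type t : (n + n).+1.-tuple bool.

(** Coupling of the bond between sites [-n + k - 1] and [-n + k]; the boundary bonds are [k = 0] and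
    [k = 2n + 1]. *)
Let J (k : nat) : R := I (- n%:Z + k%:Z).

Lemma Hplus_Omega_of_tuple t :
  Hplus I (Omega_of_tuple n t) =
  \sum_(k < (n + n).+2) J k * (nth true (true :: t) k != nth true t k)%:R.
Proof.
rewrite big_ord_recl big_ord_recr /= /Hplus.
have neq_sign (a b : bool) : ((-1) ^+ (~~ a) != (-1) ^+ (~~ b) :> int) = (a != b).
  by case: a; case: b.
have neq_sign1 (a : bool) : ((-1) ^+ (~~ a) != 1 :> int) = ~~ a by case: a.
have -> : zitv (- n%:Z + 1) n%:Z = [seq - n%:Z + 1 + i%:Z | i <- iota 0 (n + n)].
  by rewrite /zitv; congr (map _ (iota _ _)); lia.
rewrite big_map -[X in iota 0 X]subn0 -/(index_iota 0 (n + n)) big_mkord.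
have e0 := at_site_Omega_of_tuple n t 0 isT; rewrite addr0 in e0.
have en := at_site_Omega_of_tuple n t (n + n) (leqnn _).
rewrite (_ : - n%:Z + (n + n)%N%:Z = n%:Z) in en; last by lia.
rewrite e0 en !neq_sign1 [in RHS]addrA [X in X + _ = _]addrC.
congr (_ + _ + _).
- by rewrite /J addr0; case: (nth true t 0).
- apply: eq_bigr => i _; have i_n := ltn_ord i.
  rewrite (_ : - n%:Z + 1 + i%:Z - 1 = - n%:Z + i%:Z); last by lia.
  rewrite (_ : - n%:Z + 1 + i%:Z = - n%:Z + i.+1%:Z); last by lia.
  by rewrite !at_site_Omega_of_tuple ?neq_sign // ltnW.
(* Here [bump 0 (n + n)] is [2n + 1], one past the end of [t], so the default [true] acts as the
   right boundary spin. *)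
- rewrite (nth_default true (n := bump 0 (n + n))) ?size_tuple //.
  rewrite (_ : n%:Z + 1 = - n%:Z + (bump 0 (n + n))%:Z); first by case: nth.
  by rewrite /bump /=; lia.
Qed.

Lemma Hpm_Omega_of_tuple t :
  Hpm I (Omega_of_tuple n t) =
  \sum_(k < (n + n).+2) J k * (nth true (false :: t) k != nth true t k)%:R.
Proof.
have e0 := at_site_Omega_of_tuple n t 0 isT; rewrite addr0 in e0.
rewrite /Hpm Hplus_Omega_of_tuple e0 !big_ord_recl /= /J addr0 addrAC.
by congr (_ + _); case: (nth true t 0) => /=; ring.
Qed.

(** The exponential turns the sum over bonds into a product, and each 0/1 indicator becomes an
    exponent, as in [chain_partition_function]. *)
Lemma chain_boltzmann_weight (beta : R) (b : bool) t :
  expR (- beta *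
    \sum_(k < (n + n).+2) J k * (nth true (b :: t) k != nth true t k)%:R) =
  \prod_(k < (n + n).+2)
    expR (- beta * J k) ^+ (nth true (b :: t) k != nth true t k).
Proof.
rewrite mulr_sumr expR_sum; apply: eq_bigr => k _.
by rewrite mulrA expRM_natr.
Qed.

Lemma prod_symmetric_bonds (F : R -> R) :
  (forall x, I x = I (- x + 1)) ->
  \prod_(k < (n + n).+2) F (J k) = \prod_(0 <= i < n.+1) F (I (i%:Z + 1)) ^+ 2.
Proof.
move=> I_sym; rewrite big_mkord -addnS -addSn big_split_ord /=.
(* The bonds are split into [x <= 0] and [x >= 1]. Reversing the first half pairs bond [-i] with
   bond [i + 1], its image under [x -> 1 - x]. *)
rewrite (reindex_inj rev_ord_inj) -big_split /=; apply: eq_bigr => i _.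
have := ltn_ord i; rewrite ltnS => i_n.
rewrite /J (I_sym (- n%:Z + _)) expr2.
by congr (F (I _) * F (I _)); lia.
Qed.

End Energy.

Theorem proposition2p1 (R : realType) (I : int -> R)
    (I_sym : forall x : int, I x = I (- x + 1))
    (beta : R) (beta_gt0 : 0 < beta) (n : nat) :
  Zplus I beta n =
    2^-1 * (\prod_(0 <= i < n.+1) (1 + expR (- beta * I (i%:Z + 1))) ^+ 2
            + \prod_(0 <= i < n.+1) (1 - expR (- beta * I (i%:Z + 1))) ^+ 2)
  /\
  Zpm I beta n =
    2^-1 * (\prod_(0 <= i < n.+1) (1 + expR (- beta * I (i%:Z + 1))) ^+ 2
            - \prod_(0 <= i < n.+1) (1 - expR (- beta * I (i%:Z + 1))) ^+ 2).
Proof.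
pose w (k : nat) := expR (- beta * I (- n%:Z + k%:Z)).
(* The squares are unfolded back into products over all [2n + 2] bonds, one for each eigenvalue. *)
rewrite -(prod_symmetric_bonds _ I n (fun x => 1 + expR (- beta * x)) I_sym).
rewrite -(prod_symmetric_bonds _ I n (fun x => 1 - expR (- beta * x)) I_sym).
split.
- rewrite /Zplus (reindex _ (onW_bij _ (Omega_of_tuple_bij n))) /=.
  under eq_bigr do rewrite Hplus_Omega_of_tuple chain_boltzmann_weight.
  by rewrite (chain_partition_function _ _ w) expr0 mul1r.
- rewrite /Zpm (reindex _ (onW_bij _ (Omega_of_tuple_bij n))) /=.
  under eq_bigr do rewrite Hpm_Omega_of_tuple chain_boltzmann_weight.
  by rewrite (chain_partition_function _ _ w) expr1 mulN1r.
Qed.
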